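(* Let $\mathcal{A},\mathcal{B}\subsetneq \mathbb{Z}_M^2$ be alphabets, with Cantor iterates $\mathcal{X}_k,\mathcal{Y}_k\subset\mathbb{Z}_{M^k}^2$ and limiting Cantor sets $\mathbf{X},\mathbf{Y}\subset\mathbb{T}^2$ respectively. Suppose there exist $\mathbf{v}\in\mathbb{R}^2\setminus\{0\}$ and $\mathbf{p},\mathbf{q}\in\mathbb{T}^2$ such that $$\mathbb{R}\mathbf{v}+\mathbf{p}\subset\mathbf{X}\quad\text{and}\quad \mathbb{R}\mathbf{v}^{\perp}+\mathbf{q}\subset\mathbf{Y}.$$ Then $\mathcal{A},\mathcal{B}$ do not obey a fractal uncertainty principle: there are no $\beta>0$ and $C>0$ such that $\|1_{\mathcal{Y}_k}\,\mathcal{F}\,1_{\mathcal{X}_k}\|_{2\to2}\le C M^{-k\beta}$ for all $k\ge1$.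
   Context: $M$ is a positive integer (the base), $\mathbb{Z}_N=\mathbb{Z}/N\mathbb{Z}$. An alphabet is a proper subset $\mathcal{A}\subsetneq\mathbb{Z}_M^2$, with $\mathbb{Z}_M$ identified with $\{0,\dots,M-1\}$. Its $k$-th Cantor iterate is $$\mathcal{X}_k=\Big\{\Big(\sum_{j=0}^{k-1}a_jM^j,\ \sum_{j=0}^{k-1}b_jM^j\Big):(a_j,b_j)\in\mathcal{A}\text{ for all }j\Big\}\subset\mathbb{Z}_N^2,\qquad N=M^k,$$ and $\mathcal{Y}_k$ is defined in the same way from $\mathcal{B}$. $\mathbb{T}^2=\mathbb{R}^2/\mathbb{Z}^2$, identified as a set with $[0,1)^2$. The limiting Cantor set of $\mathcal{A}$ is $\mathbf{X}=\bigcap_{k\ge1}\mathbf{X}_k$, where $\mathbf{X}_k$ is the closure in $\mathbb{T}^2$ of $\{(x,y)\in[0,1)^2:(\lfloor M^kx\rfloor,\lfloor M^ky\rfloor)\in\mathcal{X}_k\}$. Equivalently, $\mathbf{X}$ is the set of points $(x,y)\in\mathbb{T}^2$ having some base-$M$ expansions $x=0.a_0a_1\dots$, $y=0.b_0b_1\dots$ with $(a_j,b_j)\in\mathcal{A}$ for all $j\ge0$ (if a coordinate has two expansions, either may be used). $\mathbf{Y}$ is defined in the same way from $\mathcal{B}$. For $\mathbf{v}=(a,b)\in\mathbb{R}^2$, $\mathbf{v}^\perp=(-b,a)$; $\mathbb{R}\mathbf{v}+\mathbf{p}\subset\mathbb{T}^2$ denotes $\{t\mathbf{v}+\mathbf{p}\bmod\mathbb{Z}^2:t\in\mathbb{R}\}$.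 $\mathcal{F}$ is the unitary discrete Fourier transform on $\ell^2(\mathbb{Z}_N^2)$: $\mathcal{F}f(\boldsymbol\xi)=\frac1N\sum_{\mathbf{x}\in\mathbb{Z}_N^2}f(\mathbf{x})e^{-\frac{2\pi i}{N}\mathbf{x}\cdot\boldsymbol\xi}$. For a set $S$, $1_S$ denotes multiplication by the indicator function of $S$, and $\|\cdot\|_{2\to2}$ is the operator norm on $\ell^2(\mathbb{Z}_N^2)$. *)

(* Defs.v *)
From HB Require Import structures.
From mathcomp Require Import all_boot all_order all_algebra.
From mathcomp Require Import complex.
From mathcomp Require Import all_classical all_reals all_analysis.
Import Order.TTheory GRing.Theory Num.Theory.
Import numFieldTopology.Exports numFieldNormedType.Exports.

Set Implicit Arguments.
Unset Strict Implicit.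
Unset Printing Implicit Defensive.

Local Open Scope classical_set_scope.
Local Open Scope ring_scope.

Section Torus.
Variable R : realType.

Definition mod_Z2 (u w : R * R) : bool :=
  (u.1 - w.1 \is a Num.int) && (u.2 - w.2 \is a Num.int).

Lemma mod_Z2_refl : reflexive mod_Z2.
Proof. by move=> u; rewrite /mod_Z2 !subrr rpred0. Qed.

Lemma mod_Z2_sym : symmetric mod_Z2.
Proof. by move=> u w; rewrite /mod_Z2 -(rpredN _ (u.1 - _)) -(rpredN _ (u.2 - _)) !opprB. Qed.

Lemma mod_Z2_trans : transitive mod_Z2.
Proof.
move=> w u z /andP[uw1 uw2] /andP[wz1 wz2]; apply/andP; split.
  by rewrite -(subrKA w.1 u.1); exact: rpredD.
by rewrite -(subrKA w.2 u.2); exact: rpredD.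
Qed.

Canonical mod_Z2_equiv := EquivRel mod_Z2 mod_Z2_refl mod_Z2_sym mod_Z2_trans.

(* T^2 = R^2/Z^2. *)
Definition torus : topologicalType :=
  quotient_topology {eq_quot mod_Z2}%qT.

Definition to_torus (u : R * R) : torus := (\pi_{eq_quot mod_Z2} u)%qT.

(* A representative in R^2, unique up to Z^2. *)
Definition of_torus (p : torus) : R * R := repr (p : {eq_quot mod_Z2}%qT).

(* The line R v + p; it does not depend on the representative of p. *)
Definition torus_line (v : R * R) (p : torus) : set torus :=
  [set to_torus (t * v.1 + (of_torus p).1, t * v.2 + (of_torus p).2) | t in [set: R]].

Definition perp (v : R * R) : R * R := (- v.2, v.1).

End Torus.

Section Cantor.
Variables (M : nat) (A : {set 'I_M * 'I_M}).

(* Z_N^2 is represented by 'I_N * 'I_N: as for the digits, each class stands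
   for its representative in {0, ..., N - 1}. *)
Definition cantor_iter (k : nat) : {set 'I_(M ^ k) * 'I_(M ^ k)} :=
  [set z : 'I_(M ^ k) * 'I_(M ^ k) | [exists d : {ffun 'I_k -> 'I_M * 'I_M},
     [&& [forall j, d j \in A],
         (z.1 == \sum_(j < k) (d j).1 * M ^ j :> nat)%N &
         (z.2 == \sum_(j < k) (d j).2 * M ^ j :> nat)%N]]]%SET.

Variable R : realType.

Definition cantor_approx (k : nat) : set (torus R) :=
  closure [set to_torus u | u in [set u : R * R |
    [/\ 0 <= u.1 < 1, 0 <= u.2 < 1 &
        exists2 z, z \in cantor_iter k &
          Num.floor ((M ^ k)%:R * u.1) = z.1%:Z /\
          Num.floor ((M ^ k)%:R * u.2) = z.2%:Z]]].

Definition limit_cantor : set (torus R) :=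
  \bigcap_(k in [set k : nat | (1 <= k)%N]) cantor_approx k.

End Cantor.

Arguments cantor_approx {M} A R k _.
Arguments limit_cantor {M} A R _.

Section Fourier.
Variable R : realType.

Definition ell2 (N : nat) : Type := {ffun 'I_N * 'I_N -> R[i]}.

Definition l2norm (N : nat) (f : ell2 N) : R :=
  Num.sqrt (\sum_x ComplexField.Normc.normc (f x) ^+ 2).

(* The operator norm; meaningful when T is linear, the supremum then being
   that of a nonempty bounded set. *)
Definition opnorm (N : nat) (T : ell2 N -> ell2 N) : R :=
  sup [set l2norm (T f) | f in [set f | l2norm f <= 1]].

(* e^{it}. *)
Definition expi (t : R) : R[i] := Complex (cos t) (sin t).

Definition dft (N : nat) (f : ell2 N) : ell2 N :=
  [ffun xi : 'I_N * 'I_N => N%:R^-1 * \sum_x f x *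
     expi (- (2 * pi / N%:R) * (x.1 * xi.1 + x.2 * xi.2)%N%:R)].

Definition mul_indic (N : nat) (S : {set 'I_N * 'I_N}) (f : ell2 N) : ell2 N :=
  [ffun x => (x \in S)%:R * f x].

End Fourier.

Definition obeys_FUP (R : realType) (M : nat) (A B : {set 'I_M * 'I_M}) : Prop :=
  exists beta C : R, [/\ 0 < beta, 0 < C &
    forall k : nat, (1 <= k)%N ->
      opnorm (@mul_indic R _ (cantor_iter B k) \o @dft R _
                \o @mul_indic R _ (cantor_iter A k))
        <= C * M%:R `^ (- (k%:R * beta))].

(* Main.v *)
Require Import Defs.
From mathcomp Require Import all_boot all_order all_algebra.
From mathcomp Require Import complex.
From mathcomp Require Import all_classical all_reals all_analysis.
From mathcomp Require Import ring lra zify.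
Import Order.TTheory GRing.Theory Num.Theory.
Import ComplexField.Normc.
Import numFieldNormedType.Exports.

(** The fractal uncertainty principle fails because the norms are bounded below
    by 1/9, uniformly in k.

    A line of irrational slope is dense in the torus, which would force the
    alphabet to be everything ([irrational_line_full]). So v is a multiple of an
    integer vector (a, b) with coprime entries ([line_direction]). Put N = M^k.
    Then the iterate X_k contains at least N / 9 points of a single coset of the
    cyclic subgroup of Z_N^2 generated by (a, b), and Y_k contains at least
    N / 9 points of a coset of the subgroup generated by (- b, a)
    ([rational_line_mass]). These two subgroups annihilate each other under the
    pairing of the Fourier transform, so, up to unimodular row and column
    factors, the Fourier matrix is the constant 1 / N on the product of the two
    sets of points; such a block has norm
    sqrt ((N / 9) (N / 9)) / N = 1/9 at least ([opnorm_dft_ge]).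

    With the full cosets the bound would be 1. Settling for a fixed fraction
    makes the argument uniform: lines parallel to an axis need no separate
    treatment, although they can run along the boundary of the cells while only
    one of the two neighbouring cells, not always on the same side, belongs to
    the iterate. *)

Set Implicit Arguments.
Unset Strict Implicit.
Unset Printing Implicit Defensive.

Local Open Scope classical_set_scope.
Local Open Scope ring_scope.

(** * Divisibility of integers *)

Lemma dvdz_eqB (d m n x : int) :
  (d %| m)%Z -> (d %| n)%Z -> x = m - n -> (d %| x)%Z.
Proof. by move=> dm dn ->; rewrite rpredB. Qed.

Lemma eq_of_dvdzB (N a b : nat) :
  (a < N)%N -> (b < N)%N -> (N %| a%:Z - b%:Z)%Z -> a = b.
Proof.
move=> aN bN; rewrite -eqz_mod_dvd => /eqP; rewrite !modz_nat !modn_small //.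
by case.
Qed.

(** * Cantor iterates seen from points of the limit set *)

Lemma floor_natMDz (R : realType) (N : nat) (x : R) (m : int) :
  Num.floor (N%:R * (m%:~R + x)) = Num.floor (N%:R * x) + N%:Z * m.
Proof.
rewrite mulrDr addrC (_ : N%:R = (N%:Z)%:~R) // -intrM.
by rewrite floorDrz ?intr_int // intrKfloor.
Qed.

(** The projection of R^2 onto the torus is open, so the image of a ball around
    u is a neighbourhood that must meet the set whose closure is taken. Working
    with an e-close point w, rather than with u, is what absorbs the ambiguity
    of double base-M expansions. *)
Lemma near_cantor (R : realType) (M : nat) (A : {set 'I_M * 'I_M}) (k : nat)
    (u : R * R) (e : R) :
  cantor_approx A R k (to_torus u) -> 0 < e ->
  exists (w : R * R) (z : 'I_(M ^ k) * 'I_(M ^ k)),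
    [/\ `|u.1 - w.1| < e /\ `|u.2 - w.2| < e, z \in cantor_iter A k,
        ((M ^ k)%N %| Num.floor ((M ^ k)%:R * w.1) - z.1%:Z)%Z &
        ((M ^ k)%N %| Num.floor ((M ^ k)%:R * w.2) - z.2%:Z)%Z].
Proof.
move=> clu e0.
pose O : set (torus R) :=
  [set to_torus w | w in [set w : R * R | ball u e w]].
have Oo : open O.
  rewrite /open/= /quotient_open openE => w [w' bw' /eqmodP].
  move=> /andP[i1 i2].
  rewrite /interior.
  have h : \forall y \near w, ball u e (y + (w' - w)).
    have c : {for w, continuous (fun y : R * R => y + (w' - w))}.
      by apply: (@cvgD _ (R * R)%type); [exact: cvg_id|exact: cvg_cst].
    apply: c; rewrite /= addrCA subrr addr0.
    by apply: open_nbhs_nbhs; split => //; exact: ball_open.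
  apply: filterS h => y by_; exists (y + (w' - w)) => //.
  by apply/eqmodP; rewrite /= /mod_Z2 /=; apply/andP; split;
    rewrite addrAC subrr add0r.
have nO : nbhs (to_torus u) O.
  by apply: open_nbhs_nbhs; split => //; exists u => //=; exact: ballxx.
have [_ [[u' [/= h1 h2 [z zA [f1 f2]]] <-] [w bw /eqmodP]]] := clu _ nO.
move=> /andP[/intrP[m /eqP]]; rewrite subr_eq => /eqP wm.
move=> /intrP[n /eqP]; rewrite subr_eq => /eqP wn.
exists w, z; move: bw => [/= b1 b2]; split => //.
- by rewrite wm floor_natMDz f1 addrAC subrr add0r dvdz_mulr.
- by rewrite wn floor_natMDz f2 addrAC subrr add0r dvdz_mulr.
Qed.

Lemma mem_cantor_iter1 (M : nat) (A : {set 'I_M * 'I_M})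
    (z : 'I_(M ^ 1) * 'I_(M ^ 1)) (x : 'I_M * 'I_M) :
  z \in cantor_iter A 1 -> z.1 = x.1 :> nat -> z.2 = x.2 :> nat -> x \in A.
Proof.
rewrite inE => /existsP[d /and3P[/forallP dA /eqP -> /eqP ->]].
rewrite !big_ord1 expn0 !muln1 => /val_inj d1 /val_inj d2.
by have := dA ord0;
  rewrite (surjective_pairing (d ord0)) d1 d2 -surjective_pairing.
Qed.

(** * Lines of irrational slope *)

(** Among the fractional parts of 0, alpha, ..., K alpha two fall in the same
    cell of length 1 / K < e; their difference d is small, nonzero by
    irrationality, and of the form n alpha + m, so its multiples are e-dense. *)
Lemma kronecker_dense (R : realType) (alpha x e : R) :
  (forall (n m : int), n != 0 -> n%:~R * alpha != m%:~R) -> 0 < e ->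
  exists n m : int, `|n%:~R * alpha + m%:~R - x| < e.
Proof.
move=> irr e0.
pose K := (Num.truncn e^-1).+1.
have K0 : (0 : R) < K%:R by rewrite ltr0n.
have eK : K%:R^-1 < e.
  by rewrite invf_plt ?posrE // truncnS_gt.
pose fr (i : nat) := i%:R * alpha - (Num.floor (i%:R * alpha))%:~R.
have frP i : 0 <= fr i < 1.
  have /andP[] := floor_itv (i%:R * alpha).
  by rewrite intrD /fr => *; lra.
have cellP i : (Num.truncn (K%:R * fr i) < K)%N.
  have /andP[f0 f1] := frP i.
  by rewrite truncn_lt_nat ?mulr_ge0 ?ler0n // gtr_pMr.
pose c (i : 'I_K.+1) : 'I_K := Ordinal (cellP i).
have [i [j [ij cij]]] : exists i j : 'I_K.+1, (i < j)%N /\ c i = c j.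
  have : ~~ injectiveb c.
    by apply/negP => /injectiveP /leq_card; rewrite !card_ord ltnn.
  move=> /injectivePn[i [j ij cij]].
  have [h|h|h] := ltngtP i j; [by exists i, j|by exists j, i|].
  by move/val_inj: h ij => ->; rewrite eqxx.
pose d := fr j - fr i.
have dE : d = (j%:Z - i%:Z)%:~R * alpha
    + (Num.floor (i%:R * alpha) - Num.floor (j%:R * alpha))%:~R.
  by rewrite /d /fr !intrD !intrN -!pmulrn; ring.
have d0 : d != 0.
  rewrite dE addr_eq0 -intrN irr //.
  by rewrite subr_eq0 eqz_nat gtn_eqF.
have dK : `|d| < K%:R^-1.
  have [fi0 fi1] := andP (frP i); have [fj0 fj1] := andP (frP j).
  have := truncn_itv (mulr_ge0 (ltW K0) fi0).
  have := truncn_itv (mulr_ge0 (ltW K0) fj0).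
  move: cij => /(congr1 val) /= -> /andP[a1 a2] /andP[a3 a4].
  rewrite -[K%:R^-1]mul1r ltr_pdivlMr // -(gtr0_norm K0) -normrM /d ltr_norml.
  by rewrite -natr1 in a2 a4; nra.
pose n := Num.floor (x / d).
exists (n * (j%:Z - i%:Z)),
  (n * (Num.floor (i%:R * alpha) - Num.floor (j%:R * alpha))).
rewrite !intrM -mulrA -mulrDr -dE; apply: le_lt_trans (lt_trans dK eK).
have -> : n%:~R * d - x = (n%:~R - x / d) * d by rewrite mulrBl divfK.
rewrite normrM ler_piMl // ler_norml.
by have := floor_itv (x / d); rewrite intrD -/n => /andP[*]; lra.
Qed.

(** The line is dense, so it comes close to the centre of every cell of side
    1 / M; hence every digit pair occurs already in the first iterate. *)
Lemma irrational_line_full (R : realType) (M : nat) (M_gt0 : (0 < M)%N)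
    (A : {set 'I_M * 'I_M}) (v : R * R) (p : torus R) :
  v.1 != 0 -> (forall n m : int, n != 0 -> n%:~R * (v.2 / v.1) != m%:~R) ->
  torus_line v p `<=` limit_cantor A R -> A = [set: 'I_M * 'I_M]%SET.
Proof.
move=> v1 irr lineA; apply/setP => x; rewrite inE.
set P := of_torus p; set al := v.2 / v.1.
have M0 : (0 : R) < M%:R by rewrite ltr0n.
pose y1 : R := (x.1%:R + 2^-1) / M%:R.
pose y2 : R := (x.2%:R + 2^-1) / M%:R.
pose e : R := 4^-1 / M%:R.
have e0 : 0 < e by rewrite divr_gt0.
(* The first coordinate is put exactly at the abscissa y1 of the centre, up to
   an integer n; density then chooses n so that the second one is near y2. *)
have [n [m nm]] := kronecker_dense (y2 - P.2 - (y1 - P.1) * al) irr e0.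
pose t := (y1 + n%:~R - P.1) / v.1.
have t1 : t * v.1 + P.1 = y1 + n%:~R by rewrite /t divfK // subrK.
have t2 : t * v.2 + P.2 = (y1 - P.1) * al + n%:~R * al + P.2.
  by rewrite /t /al; field.
have [w [z [[/= w1 w2] zA f1 f2]]] :=
  near_cantor (lineA _ (ex_intro2 _ _ t I erefl) 1 isT) e0.
have Me : M%:R * e = 4^-1 by rewrite /e mulrCA divff ?mulr1 ?gt_eqF.
have My1 : M%:R * y1 = x.1%:R + 2^-1.
  by rewrite /y1 mulrCA divff ?mulr1 ?gt_eqF.
have My2 : M%:R * y2 = x.2%:R + 2^-1.
  by rewrite /y2 mulrCA divff ?mulr1 ?gt_eqF.
have F1 : Num.floor (M%:R * w.1) = x.1%:Z + M%:Z * n.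
  apply: floor_def; rewrite !intrD intrM -!pmulrn.
  move: w1; rewrite t1 ltr_norml => /andP[w1 w1'].
  by apply/andP; split; nra.
have F2 : Num.floor (M%:R * w.2) = x.2%:Z - M%:Z * m.
  apply: floor_def; rewrite !intrD intrN intrM -!pmulrn.
  move: w2 nm; rewrite t2 !ltr_norml -/al => /andP[w2 w2'] /andP[n1 n2].
  by apply/andP; split; nra.
rewrite [X in X%:R]expn1 F1 addrAC rpredDr ?dvdz_mulr ?expn1 // in f1.
rewrite [X in X%:R]expn1 F2 addrAC rpredBr ?dvdz_mulr ?expn1 // in f2.
have [x1 x2] : (x.1 < M ^ 1 /\ x.2 < M ^ 1)%N by rewrite expn1.
apply: (mem_cantor_iter1 zA); apply: esym.
  exact: (eq_of_dvdzB x1 (ltn_ord z.1) f1).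
exact: (eq_of_dvdzB x2 (ltn_ord z.2) f2).
Qed.

(** A bound by C M^(- k beta) requires no decay when M = 1. This excludes that
    base: a nonempty limit set uses the only digit pair there is. *)
Lemma card1_cantor_full (R : realType) (A : {set 'I_1 * 'I_1}) (u : R * R) :
  cantor_approx A R 1 (to_torus u) -> A = [set: 'I_1 * 'I_1]%SET.
Proof.
move=> uA; apply/setP => x; rewrite inE.
have [_ [z [_ zA _ _]]] := near_cantor uA ltr01.
apply: (mem_cantor_iter1 zA).
  by rewrite (ord1 x.1); case: z.1 => [[]].
by rewrite (ord1 x.2); case: z.2 => [[]].
Qed.

(** When the slope is rational, reduced numerator and denominator give a coprime
    integer direction; otherwise the line is dense and the alphabet is full. *)
Lemma line_direction (R : realType) (M : nat) (M_gt0 : (0 < M)%N)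
    (A : {set 'I_M * 'I_M}) (v : R * R) (p : torus R) :
  v <> (0, 0) -> A <> [set: 'I_M * 'I_M]%SET ->
  torus_line v p `<=` limit_cantor A R ->
  exists (s : R) (a b : int),
    [/\ s != 0, coprimez a b & v = (s * a%:~R, s * b%:~R)].
Proof.
case: v => v1 v2 v0 AT lineA.
have [v10|v10] := eqVneq v1 0.
  exists v2, 0, 1; rewrite mulr0 mulr1 v10; split => //.
  by apply/eqP => v20; apply: v0; rewrite v10 v20.
have [[n [m [n0 nm]]]|irr] :=
    pselect (exists n m : int, n != 0 /\ n%:~R * (v2 / v1) = m%:~R); last first.
  case: AT; apply: (@irrational_line_full _ _ M_gt0 _ (v1, v2) _ v10 _ lineA).
  by move=> n m n0; apply/eqP => nm; apply: irr; exists n, m.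
pose q : rat := m%:~R / n%:~R.
have d0 : ((denq q)%:~R : R) != 0 by rewrite intr_eq0 denq_eq0.
have qE : (numq q)%:~R / (denq q)%:~R = v2 / v1.
  rewrite -[LHS]/(ratr q) /q fmorph_div /= !ratr_int -nm.
  by rewrite mulrC mulKf // intr_eq0.
exists (v1 / (denq q)%:~R), (denq q), (numq q); split.
- by rewrite mulf_neq0 ?invr_eq0.
- by rewrite coprimez_sym /coprimez /gcdz; have := coprime_num_den q.
- congr pair; first by rewrite divfK.
  by rewrite mulrAC -mulrA qE mulrCA divff // mulr1.
Qed.

(** * Lines of rational slope *)

Lemma pigeonhole_fiber (I J : finType) (f : I -> J) :
  (0 < #|I|)%N -> exists c, (#|I| <= #|J| * #|[set i | f i == c]%SET|)%N.
Proof.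
move=> I0; apply/existsP; rewrite -[[exists _, _]]negbK negb_exists.
apply/negP => /forallP h.
have E : #|I| = \sum_(c : J) #|[set i | f i == c]%SET|.
  rewrite -sum1_card (partition_big f predT) //=.
  by apply: eq_bigr => c _; rewrite -sum1dep_card; apply: eq_bigl.
have J0 : (0 < #|J|)%N.
  by have /card_gt0P[i _] := I0; apply/card_gt0P; exists (f i).
have : (#|J| * #|I| < #|J| * #|I|)%N.
  rewrite {1}E big_distrr /= -sum_nat_const.
  have /card_gt0P[c _] := J0.
  rewrite (bigD1 c) //= [X in (_ < X)%N](bigD1 c) //=.
  have hc c' : (#|J| * #|[set i | f i == c']%SET| < #|I|)%N.
    by rewrite ltnNge h.
  by rewrite -addSn leq_add // leq_sum // => c' _; exact: ltnW.
by rewrite ltnn.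
Qed.

(** Scale the plane by N = M^k and sample the line at the N points
    N p + j (a, b). Each sample is within distance 1 of a point whose integer
    part is in the iterate modulo N; this integer part is c + j (a, b) + e,
    where c is the integer part of N p and each coordinate of e is -1, 0 or 1
    (for a line running along a cell boundary, e can really depend on j). One
    of the 9 values of e serves at least N / 9 indices j, and since a, b are
    coprime those j give distinct points, all in one coset of the cyclic group
    generated by (a, b). *)
Lemma rational_line_mass (R : realType) (M : nat) (M_gt0 : (0 < M)%N)
    (A : {set 'I_M * 'I_M}) (s : R) (a b : int) (p : torus R) (k : nat) :
  s != 0 -> coprimez a b -> (0 < k)%N ->
  torus_line (s * a%:~R, s * b%:~R) p `<=` limit_cantor A R ->
  exists S : {set 'I_(M ^ k) * 'I_(M ^ k)},
    [/\ S \subset cantor_iter A k, (M ^ k <= 9 * #|S|)%N &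
      {in S &, forall x y : 'I_(M ^ k) * 'I_(M ^ k), exists j : int,
        ((M ^ k)%N %| (x.1%:Z - y.1%:Z) - j * a)%Z /\
        ((M ^ k)%N %| (x.2%:Z - y.2%:Z) - j * b)%Z}].
Proof.
move=> s0 /coprimezP[[u v] /= uv] k0 lineA.
set N := (M ^ k)%N; set P := of_torus p.
have N0 : (0 : R) < N%:R by rewrite ltr0n expn_gt0 M_gt0.
pose c1 := Num.floor (N%:R * P.1); pose c2 := Num.floor (N%:R * P.2).
have round (x w : R) (j : int) : `|(N%:R^-1 * j%:~R + x) - w| < N%:R^-1 ->
    exists r : 'I_3, Num.floor (N%:R * w) = Num.floor (N%:R * x) + j + r%:Z - 1.
  move=> xw.
  have /andP[x1 x2] := floor_itv (N%:R * x).
  have /andP[w1 w2] := floor_itv (N%:R * w).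
  move: xw; rewrite -(ltr_pM2l N0) divff ?gt_eqF // -{1}(gtr0_norm N0) -normrM.
  rewrite mulrBr mulrDr mulVKf ?gt_eqF // ltr_norml => /andP[d1 d2].
  set fx := Num.floor _ in x1 x2 *; set fw := Num.floor _ in w1 w2 *.
  have g1 : fw < fx + j + 2.
    by rewrite -(ltr_int R) !intrD in x2 w2 *; lra.
  have g2 : fx + j - 2 < fw.
    by rewrite -(ltr_int R) !intrD intrN in x2 w2 *; lra.
  have hr : (absz (fw - fx - j + 1)%R < 3)%N by lia.
  by exists (Ordinal hr) => /=; lia.
have pt (j : 'I_N) : exists ze : ('I_N * 'I_N) * ('I_3 * 'I_3),
    [/\ ze.1 \in cantor_iter A k,
        (N %| c1 + j%:Z * a + ze.2.1%:Z - 1 - ze.1.1%:Z)%Z &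
        (N %| c2 + j%:Z * b + ze.2.2%:Z - 1 - ze.1.2%:Z)%Z].
  have Ni : 0 < (N%:R^-1 : R) by rewrite invr_gt0.
  (* The time j / (N s) translates N times the line by exactly j (a, b). *)
  have [w [z [[/= w1 w2] zA f1 f2]]] := near_cantor
    (lineA _ (ex_intro2 _ _ (j%:R / (N%:R * s)) I erefl) k k0) Ni.
  have E (c : int) : j%:R / (N%:R * s) * (s * c%:~R) = N%:R^-1 * (j%:Z * c)%:~R.
    by rewrite intrM -pmulrn; field; rewrite s0 gt_eqF.
  rewrite !E in w1 w2.
  have [r1 e1] := round _ _ _ w1; have [r2 e2] := round _ _ _ w2.
  by exists (z, (r1, r2)); rewrite /= -e1 -e2.
have [f fP] := fin_all_exists pt.
have [|e] := @pigeonhole_fiber 'I_N _ (fun j => (f j).2).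
  by rewrite card_ord expn_gt0 M_gt0.
rewrite card_prod !card_ord => he.
pose J := [set j | (f j).2 == e]%SET.
(* Bezout recovers j modulo N from j (a, b). *)
have inj : {in J &, injective (fun j => (f j).1)}.
  move=> i j; rewrite !inE => /eqP ei /eqP ej fij.
  have [_ i1 i2] := fP i; have [_ j1 j2] := fP j.
  rewrite ei in i1 i2; rewrite ej -fij in j1 j2.
  apply: val_inj; apply: (eq_of_dvdzB (ltn_ord i) (ltn_ord j)).
  have -> : (i : nat)%:Z - (j : nat)%:Z =
      u * ((i%:Z - j%:Z) * a) + v * ((i%:Z - j%:Z) * b).
    by rewrite -[LHS]mulr1 -uv; ring.
  apply: rpredD; apply: dvdz_mull.
    by apply: (dvdz_eqB i1 j1); ring.
  by apply: (dvdz_eqB i2 j2); ring.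
exists ((fun j => (f j).1) @: J)%SET; split.
- by apply/fintype.subsetP => z /imsetP[j _ ->]; have [] := fP j.
- by rewrite card_in_imset.
- move=> _ _ /imsetP[i iJ ->] /imsetP[j jJ ->].
  have [_ i1 i2] := fP i; have [_ j1 j2] := fP j.
  move: iJ jJ; rewrite !inE => /eqP ei /eqP ej.
  rewrite ei in i1 i2; rewrite ej in j1 j2.
  exists (i%:Z - j%:Z); split.
    by apply: (dvdz_eqB j1 i1); ring.
  by apply: (dvdz_eqB j2 i2); ring.
Qed.

(** * Lower bound for the operator norm *)

Lemma normc_ge0 (R : realType) (z : R[i]) : 0 <= normc z.
Proof. by case: z => a b; exact: sqrtr_ge0. Qed.

Lemma normc_sum_le (R : realType) (I : finType) (F : I -> R[i]) :
  normc (\sum_i F i) <= \sum_i normc (F i).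
Proof.
elim/big_ind2: _ => [|x1 x2 y1 y2 h1 h2|//]; first by rewrite normc0.
by apply: le_trans (le_normcD _ _) _; exact: lerD.
Qed.

Lemma normc_nat (R : realType) (n : nat) : normc (n%:R : R[i]) = n%:R.
Proof. by rewrite normcMn normc1. Qed.

Lemma normc_expi (R : realType) (t : R) : normc (expi t) = 1.
Proof. by rewrite /expi /normc cos2Dsin2 sqrtr1. Qed.

Lemma normc_real (R : realType) (r : R) : 0 <= r -> normc (Complex r 0) = r.
Proof. by move=> r0; rewrite /normc expr0n addr0 sqrtr_sqr ger0_norm. Qed.

Lemma expiD (R : realType) (s t : R) : expi (s + t) = expi s * expi t.
Proof.
rewrite /expi cosD sinD; apply/eqP; rewrite eq_complex /=; apply/andP.
by split => //; apply/eqP; rewrite addrC mulrC [sin t * _]mulrC.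
Qed.

Lemma expi_period (R : realType) (t : R) (m : int) :
  expi (t + 2 * pi * m%:~R) = expi t.
Proof.
have nat_period (s : R) (n : nat) : expi (s + 2 * pi * n%:R) = expi s.
  rewrite mulr_natr mulr_natl /expi.
  by rewrite (periodicn (@cosD2pi R)) (periodicn (@sinD2pi R)).
case: m => n; first exact: nat_period.
by rewrite NegzE intrN -pmulrn -[LHS](nat_period _ n.+1) mulrN subrK.
Qed.

(** Needed so that the supremum defining the operator norm dominates each of
    its values; each coefficient of a function in the unit ball has modulus at
    most 1, which is enough for a crude bound. *)
Lemma mul_dft_mul_bounded (R : realType) (N : nat)
    (X Y : {set 'I_N * 'I_N}) :
  has_ubound [set l2norm ((@mul_indic R _ Y \o @dft R _ \o @mul_indic R _ X) f)
             | f in [set f | l2norm f <= 1]].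
Proof.
pose c : R := N%:R^-1 * \sum_(x : 'I_N * 'I_N) 1.
have c0 : 0 <= c by rewrite mulr_ge0 ?invr_ge0 ?ler0n // sumr_ge0.
exists (Num.sqrt (\sum_(x : 'I_N * 'I_N) c ^+ 2)) => _ [f /= f1 <-].
have fx x : normc (f x) <= 1.
  apply: le_trans f1; rewrite -[leLHS]ger0_norm ?normc_ge0 // -sqrtr_sqr.
  rewrite ler_wsqrtr // (bigD1 x) //= lerDl sumr_ge0 // => y _.
  exact: sqr_ge0.
have ind_le (Z : {set 'I_N * 'I_N}) x : normc ((x \in Z)%:R : R[i]) <= 1.
  by rewrite normc_nat lern1 leq_b1.
rewrite ler_wsqrtr // ler_sum // => xi _.
rewrite lerXn2r ?nnegrE ?normc_ge0 // !ffunE normcM.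
rewrite -[leRHS]mul1r ler_pM ?normc_ge0 // normcM normcV normc_nat.
rewrite ler_wpM2l ?invr_ge0 ?ler0n //.
apply: le_trans (normc_sum_le _) _; apply: ler_sum => x _.
rewrite ffunE !normcM normc_expi mulr1.
by rewrite -[leRHS]mul1r ler_pM ?normc_ge0.
Qed.

(** The divisibility hypothesis says that x - x0 and xi - xi0 pair to 0 modulo
    N. Then the S x T block of the Fourier matrix is, up to unimodular factors
    depending on x alone and on xi alone, the constant 1 / N: it has rank one
    and norm sqrt (#|S| #|T|) / N. The test function is the indicator of S
    modulated by the frequency xi0, for which all the terms summed at a point of
    T are equal. *)
Lemma opnorm_dft_ge (R : realType) (N : nat) (X Y S T : {set 'I_N * 'I_N})
    (x0 xi0 : 'I_N * 'I_N) :
  x0 \in S -> xi0 \in T -> S \subset X -> T \subset Y ->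
  (forall x xi : 'I_N * 'I_N, x \in S -> xi \in T ->
    (N %| (x.1%:Z - x0.1%:Z) * (xi.1%:Z - xi0.1%:Z)
        + (x.2%:Z - x0.2%:Z) * (xi.2%:Z - xi0.2%:Z))%Z) ->
  Num.sqrt (#|S| * #|T|)%:R / N%:R <=
    opnorm (@mul_indic R _ Y \o @dft R _ \o @mul_indic R _ X).
Proof.
move=> x0S xi0T /fintype.subsetP SX /fintype.subsetP TY orth.
have N0 : (0 : R) < N%:R by rewrite ltr0n (leq_ltn_trans _ (ltn_ord x0.1)).
have S0 : (0 : R) < #|S|%:R by rewrite ltr0n; apply/card_gt0P; exists x0.
have sS0 : 0 < Num.sqrt (#|S|%:R : R) by rewrite sqrtr_gt0.
pose th : R := 2 * pi / N%:R.
pose dot (x xi : 'I_N * 'I_N) : R := (x.1 * xi.1 + x.2 * xi.2)%N%:R.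
pose f : ell2 R N := [ffun x =>
  (x \in S)%:R * (Complex (Num.sqrt #|S|%:R)^-1 0 * expi (th * dot x xi0))].
have f1 : l2norm f <= 1.
  rewrite /l2norm (eq_bigr (fun x => if x \in S then #|S|%:R^-1 else 0)).
    rewrite -big_mkcond sumr_const -[X in Num.sqrt X]mulr_natr.
    by rewrite mulVf ?gt_eqF // sqrtr1.
  move=> x _; rewrite ffunE !normcM normc_nat normc_expi mulr1.
  rewrite normc_real ?invr_ge0 ?ltW //; case: ifP => _.
    by rewrite mul1r exprVn sqr_sqrtr // ltW.
  by rewrite mul0r expr0n.
have phase x xi : x \in S -> xi \in T ->
    expi (th * dot x xi0) * expi (- th * dot x xi) =
    expi (th * dot x0 xi0 - th * dot x0 xi).
  move=> xS xiT; rewrite -expiD.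
  have /dvdzP[m mE] := orth _ _ xS xiT.
  rewrite -(expi_period _ m); congr expi.
  have {}mE : (m%:~R : R) * N%:R = (x.1%:R - x0.1%:R) * (xi.1%:R - xi0.1%:R)
        + (x.2%:R - x0.2%:R) * (xi.2%:R - xi0.2%:R).
    have := congr1 (fun z : int => (z%:~R : R)) mE.
    by rewrite !(intrD, intrM, intrN) -!pmulrn.
  have {}mE : m%:~R = (dot x xi - dot x xi0 - dot x0 xi + dot x0 xi0) / N%:R.
    apply/(canRL (mulfK _)); first by rewrite gt_eqF.
    by rewrite mE /dot !natrD !natrM; ring.
  by rewrite mE /th; field; rewrite gt_eqF.
apply: le_trans (ub_le_sup (mul_dft_mul_bounded R X Y) _ : _ <= _); last first.
  by exists f.
have -> : Num.sqrt (#|S| * #|T|)%:R / N%:R =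
    Num.sqrt (\sum_(xi in T) (Num.sqrt #|S|%:R / N%:R) ^+ 2) :> R.
  rewrite sumr_const -[X in _ = Num.sqrt X]mulr_natr expr_div_n.
  rewrite sqr_sqrtr ?ltW // natrM.
  rewrite mulrAC [RHS]sqrtrM ?mulr_ge0 ?ler0n // sqrtrV ?exprn_ge0 ?ler0n //.
  by rewrite sqrtr_sqr gtr0_norm.
rewrite ler_wsqrtr // big_mkcond /= ler_sum // => xi _.
case: ifPn => [xiT|_]; last exact: sqr_ge0.
suff -> : normc (((@mul_indic R _ Y \o @dft R _ \o @mul_indic R _ X) f) xi) =
    Num.sqrt #|S|%:R / N%:R by [].
rewrite !ffunE (TY _ xiT) mul1r.
have -> : \sum_x (mul_indic X f) x *
    expi (- (2 * pi / N%:R) * (x.1 * xi.1 + x.2 * xi.2)%N%:R) =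
    #|S|%:R * (Complex (Num.sqrt #|S|%:R)^-1 0 *
      expi (th * dot x0 xi0 - th * dot x0 xi)).
  rewrite -sumr_const mulr_suml [RHS]big_mkcond /=; apply: eq_bigr => x _.
  rewrite !ffunE; case: ifPn => [xS|xS]; last by rewrite !(mul0r, mulr0).
  by rewrite (SX _ xS) !mul1r -[LHS]mulrA; congr (_ * _); exact: phase.
rewrite !normcM normcV !normc_nat normc_expi normc_real ?invr_ge0 ?ltW //.
rewrite mulr1 mulrC; congr (_ / _).
by rewrite -{1}(sqr_sqrtr (ltW S0)) expr2 mulfK // gt_eqF.
Qed.

(** * Failure of the uncertainty principle *)

Lemma geometric_decay (R : realType) (M : nat) (beta C c : R) :
  (1 < M)%N -> 0 < beta -> 0 < C -> 0 < c ->
  exists2 k : nat, (0 < k)%N & C * M%:R `^ (- (k%:R * beta)) < c.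
Proof.
move=> M1 b0 C0 c0.
have M0 : (0 : R) < M%:R by rewrite ltr0n (ltn_trans _ M1).
have lM : 0 < ln (M%:R : R) by rewrite ln_gt0 // ltr1n.
have bl : 0 < beta * ln M%:R by rewrite mulr_gt0.
exists (Num.truncn (C / c / (beta * ln M%:R))).+1 => //.
set k := _.+1.
have hk : C / c < k%:R * (beta * ln M%:R).
  by rewrite -ltr_pdivrMr // truncnS_gt.
rewrite powRN -ltr_pdivlMl // -[c in X in _ < X]invrK -invfM.
rewrite ltf_pV2 ?posrE ?powR_gt0 ?divr_gt0 //.
rewrite /powR gt_eqF // -mulrA; apply: lt_le_trans (expR_ge1Dx _).
by rewrite mulrC; lra.
Qed.

Theorem mainTheorem2 (R : realType) (M : nat) (M_gt0 : (0 < M)%N)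
  (A B : {set 'I_M * 'I_M})
  (A_proper : (A \proper [set: 'I_M * 'I_M]%SET)%SET)
  (B_proper : (B \proper [set: 'I_M * 'I_M]%SET)%SET) :
  (exists (v : R * R) (p q : torus R),
     [/\ v <> (0, 0),
         torus_line v p `<=` limit_cantor A R &
         torus_line (perp v) q `<=` limit_cantor B R]) ->
  ~ obeys_FUP R A B.
Proof.
move=> [v [p [q [v0 lineA lineB]]]] [beta [C [beta0 C0 fup]]].
have AT : A <> [set: 'I_M * 'I_M]%SET.
  by move=> AT; rewrite AT fintype.properxx in A_proper.
have M1 : (1 < M)%N.
  rewrite ltn_neqAle M_gt0 andbT; apply/eqP => M1; subst M.
  exact: AT (card1_cantor_full (lineA _ (ex_intro2 _ _ 0 I erefl) 1 isT)).
have [s [a [b [s0 ab vE]]]] := line_direction M_gt0 v0 AT lineA.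
rewrite vE in lineA.
rewrite vE /perp /= -mulrN -intrN in lineB.
have ba : coprimez (- b) a by rewrite coprimez_sym coprimezN.
have c0 : (0 : R) < 9^-1 by [].
have [k k0] := geometric_decay M1 beta0 C0 c0.
rewrite ltNge => /negP; apply; apply: le_trans (fup k k0).
have [S [SX cardS Sdir]] := rational_line_mass M_gt0 s0 ab k0 lineA.
have [T [TY cardT Tdir]] := rational_line_mass M_gt0 s0 ba k0 lineB.
set N := (M ^ k)%N in S SX cardS Sdir T TY cardT Tdir *.
have N0 : (0 < N)%N by rewrite expn_gt0 M_gt0.
have [x0 x0S] : exists x, x \in S by apply/card_gt0P; lia.
have [xi0 xi0T] : exists xi, xi \in T by apply/card_gt0P; lia.
apply: le_trans (opnorm_dft_ge R x0S xi0T SX TY _).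
  rewrite ler_pdivlMr ?ltr0n // -[leLHS]gtr0_norm ?mulr_gt0 ?ltr0n //.
  rewrite -sqrtr_sqr ler_wsqrtr // exprMn natrM expr2 -mulrA.
  have cS : (N%:R : R) <= 9 * #|S|%:R by rewrite -natrM ler_nat.
  have cT : (N%:R : R) <= 9 * #|T|%:R by rewrite -natrM ler_nat.
  have N0R : (0 : R) < N%:R by rewrite ltr0n.
  by nra.
move=> x xi xS xiT.
have [j [/dvdzP[c1 e1] /dvdzP[c2 e2]]] := Sdir _ _ xS x0S.
have [i [/dvdzP[d1 g1] /dvdzP[d2 g2]]] := Tdir _ _ xiT xi0T.
move/eqP: e1; rewrite subr_eq => /eqP ->.
move/eqP: e2; rewrite subr_eq => /eqP ->.
move/eqP: g1; rewrite subr_eq => /eqP ->.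
move/eqP: g2; rewrite subr_eq => /eqP ->.
(* Modulo N the pairing is j a (- i b) + j b (i a) = 0. *)
apply/dvdzP; exists (c1 * (d1 * N%:Z - i * b) + c2 * (d2 * N%:Z + i * a)
  + j * a * d1 + j * b * d2).
ring.
Qed.
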